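(* Let $\mathcal{R}$ be a finite-dimensional non-nilpotent complex solvable Lie superalgebra with nilradical $\mathcal{N}$ such that $[\mathcal{R},\mathcal{R}]\subseteq\mathcal{N}$. Then $$\dim(\mathcal{R}/\mathcal{N})\leq\dim(\mathcal{N}/[\mathcal{N},\mathcal{N}]).$$
   Context: A Lie superalgebra $\mathcal{L}=\mathcal{L}_0\oplus\mathcal{L}_1$ is a $\mathbb{Z}_2$-graded vector space with an even bilinear bracket satisfying super skew-symmetry $[x,y]=-(-1)^{|x||y|}[y,x]$ and the super Jacobi identity. It is nilpotent if its lower central series $\mathcal{L}^1=\mathcal{L}$, $\mathcal{L}^{j+1}=[\mathcal{L}^j,\mathcal{L}]$ reaches $0$, and solvable if its derived series reaches $0$. The nilradical is the maximal nilpotent ideal. *)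

(* Defs.v *)
From HB Require Import structures.
From mathcomp Require Import all_boot all_order all_algebra.
From mathcomp Require Import complex.
From mathcomp Require Import reals.

Set Implicit Arguments.
Unset Strict Implicit.
Unset Printing Implicit Defensive.

Import GRing.Theory Num.Theory.
Local Open Scope ring_scope.

(* Parities are booleans: [false] is even, [true] is odd, [a (+) b] is the sum
   in Z/2 and [a && b] the product.  The scalars form a numFieldType, hence
   have characteristic 0, so no extra axioms for characteristics 2 and 3 are
   needed.  A vectType is finite-dimensional. *)
HB.mixin Record Vector_isLieSuperalgebra (K : numFieldType) L
    of Vector K L := {
  homog : bool -> {vspace L};
  bracket : L -> L -> L;
  homog_add : (homog false + homog true)%VS = fullv;
  homog_cap : (homog false :&: homog true)%VS = 0%VS;
  bracket_linearl : forall y, linear (fun x => bracket x y);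
  bracket_linearr : forall x, linear (bracket x);
  bracket_homog : forall a b x y, x \in homog a -> y \in homog b ->
    bracket x y \in homog (a (+) b);
  bracket_skew : forall a b x y, x \in homog a -> y \in homog b ->
    bracket x y = - ((-1) ^+ (a && b) *: bracket y x);
  bracket_jacobi : forall a b x y z, x \in homog a -> y \in homog b ->
    bracket x (bracket y z) =
      bracket (bracket x y) z + (-1) ^+ (a && b) *: bracket y (bracket x z)
}.

#[short(type="lieSuperalgebraType")]
HB.structure Definition LieSuperalgebra (K : numFieldType) :=
  { L of Vector_isLieSuperalgebra K L & Vector K L }.

Section LieSuperalgebraTheory.
Variables (K : numFieldType) (L : lieSuperalgebraType K).
Implicit Types U V W I N : {vspace L}.

Definition bracketv U V : {vspace L} :=
  <<[seq bracket u v | u <- vbasis U, v <- vbasis V]>>%VS.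

(* [bracketv U V] is the span of all the brackets, not only of those of basis
   vectors. *)
Lemma bracketv_subP U V W :
  (forall u v, u \in U -> v \in V -> bracket u v \in W) <->
  (bracketv U V <= W)%VS.
Proof.
split=> [UVW | /subvP sUVW u v uU vV].
  by apply/span_subvP => _ /allpairsP[[u v] /= [/vbasis_mem uU /vbasis_mem vV ->]];
     apply: UVW.
pose lf y := GRing.isLinear.Build K L L _ _ (bracket_linearl y).
pose rf x := GRing.isLinear.Build K L L _ _ (@bracket_linearr K L x).
pose l y : {linear L -> L} := HB.pack (fun x : L => bracket x y) (lf y).
pose r x : {linear L -> L} := HB.pack (bracket x) (rf x).
rewrite (coord_vbasis uU) -[bracket _ v]/(l v _) linear_sum /=.
apply: rpred_sum => i _; rewrite -[bracket _ v]/(l v _) linearZ rpredZ //=.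
rewrite (coord_vbasis vV) -[bracket _ _]/(r _ _) linear_sum /=.
apply: rpred_sum => j _; rewrite -[bracket _ _]/(r _ _) linearZ rpredZ //=.
by apply/sUVW/memv_span/allpairs_f; apply: mem_nth; rewrite size_tuple.
Qed.

Definition graded_subspace U : Prop :=
  U = (U :&: homog false + U :&: homog true)%VS.

(* For a graded subspace, super skew-symmetry makes left and right ideals
   coincide. *)
Definition is_ideal I : Prop :=
  graded_subspace I /\ (bracketv I fullv <= I)%VS.

(* [lower_central U j] is U^(j+1) in the numbering where U^1 = U. *)
Definition lower_central U (j : nat) : {vspace L} :=
  iter j (fun V => bracketv V U) U.

Definition derived_series U (j : nat) : {vspace L} :=
  iter j (fun V => bracketv V V) U.

Definition is_nilpotent U : Prop := exists j, lower_central U j = 0%VS.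

Definition is_solvable U : Prop := exists j, derived_series U j = 0%VS.

(* Sums of nilpotent ideals are nilpotent, so maximal for inclusion is the same
   as largest. *)
Definition is_nilradical N : Prop :=
  [/\ is_ideal N, is_nilpotent N &
      forall I, is_ideal I -> is_nilpotent I -> (N <= I)%VS -> I = N].

(* [U :\: V] is a complement of [U :&: V] in [U]; for [V <= U] it is a model of
   the quotient [U / V]. *)
Definition dim_quotient U V : nat := \dim (U :\: V)%VS.

End LieSuperalgebraTheory.

(* Main.v *)
(* Since [L, L] lies in N, the operators ad x supercommute on N / [N, N], so a
   homogeneous odd x satisfies (ad x)^2 = 0 there.  Hence [N, N] and N are
   joined by a flag of ad-stable subspaces on whose successive quotients even
   elements act by scalars and odd elements by 0.  The common kernel J of these
   at most dim (N / [N, N]) weights contains N and every odd element, and it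
   acts nilpotently on N / [N, N], hence on N by the Leibniz rule along the lower
   central series.  So J is a nilpotent ideal containing N: it equals N, and the
   codimension of N is at most the number of weights. *)
Require Import Defs.
From HB Require Import structures.
From mathcomp Require Import all_boot all_order all_algebra.
From mathcomp Require Import complex.
From mathcomp Require Import reals.
From Stdlib Require Import Classical.

(** * Brackets of graded subspaces and a nilpotency criterion modulo [[N, N]] *)

Section NilpotencyCriterion.
Set Implicit Arguments.
Unset Strict Implicit.
Unset Printing Implicit Defensive.
Local Open Scope ring_scope.
Import GRing.Theory Num.Theory.
Variables (K : numFieldType) (L : lieSuperalgebraType K).
Implicit Types (A B C J U V W : {vspace L}) (x y u v w : L) (a b : bool).

HB.instance Definition _ x :=
  GRing.isLinear.Build K L L _ (bracket x) (@bracket_linearr K L x).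

Definition rbracket y x : L := bracket x y.

HB.instance Definition _ y :=
  GRing.isLinear.Build K L L _ (rbracket y) (@bracket_linearl K L y).

Lemma bracketDl x y z : bracket (x + y) z = bracket x z + bracket y z.
Proof. exact: (linearD (rbracket z)). Qed.

Lemma bracketBl x y z : bracket (x - y) z = bracket x z - bracket y z.
Proof. exact: (linearB (rbracket z)). Qed.

Lemma bracketZl c x y : bracket (c *: x) y = c *: bracket x y.
Proof. exact: (linearZ_LR (rbracket y)). Qed.

Lemma mem_bracketv U V u v :
  u \in U -> v \in V -> bracket u v \in bracketv U V.
Proof. by apply: (bracketv_subP U V _).2. Qed.

Lemma bracketvS U U' V V' :
  (U <= U')%VS -> (V <= V')%VS -> (bracketv U V <= bracketv U' V')%VS.
Proof.
move=> /subvP sU /subvP sV; apply/bracketv_subP => u v uU vV.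
by apply: mem_bracketv; [apply: sU | apply: sV].
Qed.

Lemma bracketvDr U V W :
  (bracketv U (V + W) <= bracketv U V + bracketv U W)%VS.
Proof.
apply/bracketv_subP => u y uU /memv_addP[v vV [w wW ->]].
by rewrite linearD memv_add ?mem_bracketv.
Qed.

Lemma graded_subspaceP U :
  graded_subspace U <->
  (forall u, u \in U -> exists2 v, v \in (U :&: homog false)%VS &
     exists2 w, w \in (U :&: homog true)%VS & u = v + w).
Proof.
split=> [gU u|gU]; first by rewrite {1}gU => /memv_addP.
apply/eqP; rewrite eqEsubv subv_add !capvSl !andbT.
by apply/subvP => u /gU[v vU [w wU ->]]; apply: memv_add.
Qed.

Lemma homog_sum x : exists2 v, v \in homog false &
  exists2 w, w \in homog true & x = v + w.
Proof. by apply/memv_addP; rewrite homog_add memvf. Qed.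

(** Skew-symmetry and the Jacobi identity are given on homogeneous elements; a grading reduces
    inclusions of brackets to that case. *)
Lemma graded_bracketv_subP U V W : graded_subspace U ->
  (forall a u v, u \in U -> u \in homog a -> v \in V -> bracket u v \in W) ->
  (bracketv U V <= W)%VS.
Proof.
move=> /graded_subspaceP gU UVW; apply/bracketv_subP => x v.
move=> /gU[u /memv_capP[uU u0] [u' /memv_capP[u'U u'1] ->]] vV.
by rewrite bracketDl rpredD //; [apply: (UVW false) | apply: (UVW true)].
Qed.

Lemma bigraded_bracketv_subP U V W : graded_subspace U -> graded_subspace V ->
  (forall a b u v, u \in U -> u \in homog a -> v \in V -> v \in homog b ->
     bracket u v \in W) ->
  (bracketv U V <= W)%VS.
Proof.
move=> gU /graded_subspaceP gV UVW.
apply: graded_bracketv_subP => // a u y uU ua.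
move=> /gV[v /memv_capP[vV v0] [v' /memv_capP[v'V v'1] ->]].
by rewrite linearD rpredD //; [apply: (UVW a false) | apply: (UVW a true)].
Qed.

Lemma graded_bracketv U V :
  graded_subspace U -> graded_subspace V -> graded_subspace (bracketv U V).
Proof.
move=> gU gV; apply/eqP; rewrite eqEsubv subv_add !capvSl !andbT.
apply: bigraded_bracketv_subP => // a b u v uU ua vV vb.
have: bracket u v \in (bracketv U V :&: homog (a (+) b))%VS.
  by rewrite memv_cap mem_bracketv // bracket_homog.
by case: (a (+) b); apply: subvP; [apply: addvSr | apply: addvSl].
Qed.

Lemma bracketv_gradedC U V :
  graded_subspace U -> graded_subspace V -> bracketv U V = bracketv V U.
Proof.
suff sUV U' V' : graded_subspace U' -> graded_subspace V' ->
    (bracketv U' V' <= bracketv V' U')%VS.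
  by move=> gU gV; apply/eqP; rewrite eqEsubv !sUV.
move=> gU gV; apply: bigraded_bracketv_subP => // a b u v uU ua vV vb.
by rewrite (bracket_skew _ _ _ _ ua vb) rpredN rpredZ // mem_bracketv.
Qed.

Lemma bracketv_jacobil A B C : graded_subspace A -> graded_subspace B ->
  (bracketv A (bracketv B C)
     <= bracketv (bracketv A B) C + bracketv B (bracketv A C))%VS.
Proof.
move=> gA gB; apply: graded_bracketv_subP => // a x v xA xa vBC.
(* As a preimage, the goal is a subspace condition on [v], so [v] may be taken among brackets
   spanning [bracketv B C]. *)
have -> : bracket x v = linfun (bracket x) v by rewrite lfunE.
rewrite memv_preim; move: v vBC; apply/subvP.
apply: graded_bracketv_subP => // b y z yB yb zC.
rewrite -memv_preim lfunE /= (bracket_jacobi _ _ _ _ z xa yb).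
by rewrite memv_add ?rpredZ ?mem_bracketv.
Qed.

Lemma bracketv_jacobir A B C : graded_subspace A -> graded_subspace B ->
  (bracketv (bracketv A B) C
     <= bracketv A (bracketv B C) + bracketv B (bracketv A C))%VS.
Proof.
move=> gA gB; apply/bracketv_subP => v z vAB zC.
have -> : bracket v z = linfun (rbracket z) v by rewrite lfunE.
rewrite memv_preim; move: v vAB; apply/subvP.
apply: bigraded_bracketv_subP => // a b x y xA xa yB yb.
rewrite -memv_preim lfunE /= /rbracket.
have -> : bracket (bracket x y) z =
    bracket x (bracket y z) - (-1) ^+ (a && b) *: bracket y (bracket x z).
  by rewrite (bracket_jacobi _ _ _ _ z xa yb) addrK.
by rewrite memv_add ?rpredN ?rpredZ // !mem_bracketv.
Qed.

(** * Iterated action of a subspace by brackets *)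

Definition iter_bracket J k V := iter k (bracketv J) V.

Lemma iter_bracketS J k V W :
  (V <= W)%VS -> (iter_bracket J k V <= iter_bracket J k W)%VS.
Proof. by move=> sVW; elim: k => //= k; apply: bracketvS. Qed.

Lemma iter_bracketD J k V W :
  (iter_bracket J k (V + W) <= iter_bracket J k V + iter_bracket J k W)%VS.
Proof.
elim: k => //= k IHk.
by apply: subv_trans (bracketvDr _ _ _); apply: bracketvS.
Qed.

Lemma iter_bracket_stable J k V :
  (bracketv J V <= V)%VS -> (iter_bracket J k V <= V)%VS.
Proof.
move=> sV; elim: k => //= k IHk.
by apply: subv_trans sV; apply: bracketvS.
Qed.

(* Leibniz rule: of the [k + m] derivations applied to [A, B], at least [k]
   fall on [A] or at least [m] fall on [B]. *)
Lemma iter_bracket_bracketv J A B C k m :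
  graded_subspace J -> graded_subspace A ->
  (bracketv J A <= A)%VS -> (bracketv J B <= B)%VS -> (bracketv J C <= C)%VS ->
  (bracketv (iter_bracket J k A) B <= C)%VS ->
  (bracketv A (iter_bracket J m B) <= C)%VS ->
  (iter_bracket J (k + m) (bracketv A B) <= C)%VS.
Proof.
move=> gJ + + + sC; elim: k m A B => [|k IHk] m A B gA sA sB.
  move=> sABC _; apply: subv_trans (iter_bracket_stable m sC).
  exact: iter_bracketS.
elim: m B sB => [|m IHm] B sB sAC sBC.
  apply: subv_trans (iter_bracket_stable (k.+1 + 0) sC).
  exact: iter_bracketS.
(* Jacobi sends the innermost derivation to [A], lowering [k], or to [B], lowering [m]. *)
rewrite addSn /iter_bracket iterSr -/(iter_bracket _ _ _).
apply: (subv_trans (iter_bracketS _ _ (bracketv_jacobil _ gJ gA))).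
apply: (subv_trans (iter_bracketD _ _ _ _)); rewrite subv_add.
apply/andP; split.
  apply: IHk => //.
  - exact: graded_bracketv.
  - exact: bracketvS.
  - by rewrite /iter_bracket -iterSr.
  - by apply: subv_trans sBC; apply: bracketvS.
rewrite addnS -addSn; apply: IHm => //.
- exact: bracketvS.
- by apply: subv_trans sAC; apply: bracketvS.
- by rewrite /iter_bracket -iterSr.
Qed.

Lemma graded_iter_bracket J k V :
  graded_subspace J -> graded_subspace V ->
  graded_subspace (iter_bracket J k V).
Proof. by move=> gJ gV; elim: k => //= k; apply: graded_bracketv. Qed.

Lemma lower_centralE J k :
  graded_subspace J -> lower_central J k = iter_bracket J k J.
Proof.
move=> gJ; elim: k => //= k IHk; rewrite -/(lower_central J k) IHk.
by apply: bracketv_gradedC => //; apply: graded_iter_bracket.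
Qed.

Lemma iter_bracket_ideal J N k : graded_subspace J -> graded_subspace N ->
  (bracketv J N <= N)%VS ->
  (bracketv J (iter_bracket N k N) <= iter_bracket N k N)%VS.
Proof.
move=> gJ gN sN; elim: k => //= k IHk.
apply: subv_trans (bracketv_jacobil _ gJ gN) _.
by rewrite subv_add !bracketvS.
Qed.

(** The Leibniz rule carries nilpotency of [J] on [N / [N, N]] down the lower central series of [N],
    so some power of [J] kills [N], which contains [[J, J]]. *)
Lemma nilpotent_mod_derived J N k : graded_subspace J -> graded_subspace N ->
  (bracketv J N <= N)%VS -> (bracketv J J <= N)%VS ->
  is_nilpotent N -> (iter_bracket J k N <= bracketv N N)%VS -> is_nilpotent J.
Proof.
move=> gJ gN sJN sJJ [n nilN] sk; pose Nj j := iter_bracket N j N.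
have sJ j := iter_bracket_ideal j gJ gN sJN.
have step j : exists m, (iter_bracket J m (Nj j) <= Nj j.+1)%VS.
  elim: j => [|j [m IHj]]; first by exists k.
  (* [k] derivations move [N] into [[N, N]], and [[[N, N], Nj j]] lies in [Nj j.+2]; [m] derivations
     move [Nj j] into [Nj j.+1]. *)
  exists (k + m)%N; apply: iter_bracket_bracketv => //; first exact: sJ.
  - exact: sJ.
  - apply: subv_trans (bracketvS sk (subvv _)) _.
    by apply: subv_trans (bracketv_jacobir _ gN gN) _; rewrite addvv.
  - exact: bracketvS.
have [m sm] : exists m, (iter_bracket J m N <= Nj n)%VS.
  elim: (n) => [|j [m IHj]]; first by exists 0.
  have [m' sm'] := step j; exists (m' + m)%N.
  rewrite /iter_bracket iterD; apply: subv_trans sm'.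
  exact: iter_bracketS.
(* The extra bracket first moves [J] into [N]. *)
exists m.+1; apply/eqP; rewrite lower_centralE // /iter_bracket iterSr -subv0.
by rewrite -nilN lower_centralE //; apply: subv_trans sm; apply: iter_bracketS.
Qed.

End NilpotencyCriterion.

(** * Weights on [N / [N, N]] and their common kernel *)

Section WeightFlag.
Import VectorInternalTheory.
Local Open Scope ring_scope.
Import GRing.Theory Num.Theory.
Set Implicit Arguments.
Unset Strict Implicit.
Unset Printing Implicit Defensive.

Lemma eigenvector_exists (K : numClosedFieldType) (V : vectType K)
    (g : {linear V -> V}) :
  (0 < \dim {:V})%N -> exists c u, u != 0 /\ g u = c *: u.
Proof.
rewrite dimvf => dimV.
have [c /eigenvalueP[v vc v0]] :=
  eigenvalue_closed (lin1_mx (v2r \o g \o r2v)) dimV.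
exists c, (r2v v); split.
  by apply: contra v0 => /eqP v0; rewrite -(r2vK v) v0 linear0.
by apply: (can_inj v2rK); rewrite linearZ /= r2vK -vc mul_rV_lin1.
Qed.

(** The complement [U] models [W / F]; the eigenvector is one of [f] followed by the projection onto
    [U] along [F]. *)
Lemma eigenvector_mod (K : numClosedFieldType) (V : vectType K) (f : 'End(V))
    (F W : {vspace V}) :
  (F <= W)%VS -> (f @: W <= W)%VS -> ~~ (W <= F)%VS ->
  exists c w, [/\ w \in W, w \notin F & f w - c *: w \in F].
Proof.
move=> sFW fW nWF; pose U := (W :\: F)%VS.
pose g := linfun (vsproj U) \o addv_pi1 W F \o f \o linfun (@vsval _ _ U).
have dimU : (0 < \dim {:subvs_of U})%N.
  by rewrite dimvf lt0n dimv_eq0 diffv_eq0.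
have [c [u [u0 gu]]] := eigenvector_exists g dimU.
have uW : val u \in W by apply: subvP (subvsP u); apply: diffvSl.
exists c, (val u); split=> //.
  apply: contra u0 => uF; rewrite -val_eqE /= -memv0 -(capv_diff W F).
  by rewrite memv_cap subvsP.
have fuW : f (val u) \in (W + F)%VS.
  by apply: subvP (addvSl _ _) _ _; apply: subvP fW _ _; apply: memv_img.
rewrite -(addv_pi1_pi2 fuW).
have -> : addv_pi1 W F (f (val u)) = c *: val u.
  rewrite -[c *: val u]/(val (c *: u)) -gu /g /= !lfunE /= vsprojK //.
  exact: memv_pi.
by rewrite addrAC subrr add0r memv_pi2.
Qed.

(** The hypothesis expresses codimension at most 1 without a linear form. *)
Lemma dimv_cap_hyperplane (K : fieldType) (V : vectType K) (P J : {vspace V}) :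
  (forall x z, z \notin P -> exists c, x - c *: z \in P) ->
  (\dim J <= (\dim (J :&: P)).+1)%N.
Proof.
move=> hypP; have [sJP|/subvPn[z zJ zP]] := boolP (J <= P)%VS.
  by rewrite (capv_idPl sJP).
have sJ : (J <= (J :&: P) + <[z]>)%VS.
  apply/subvP => x xJ; have [c xcz] := hypP x z zP.
  rewrite -[x](subrK (c *: z)) memv_add ?memvZ ?memv_line //.
  by rewrite memv_cap xcz rpredB ?memvZ.
apply: leq_trans (dimvS sJ) _; apply: leq_trans (dimv_add_leqif _ _) _.
by rewrite -addn1 leq_add2l dim_vline leq_b1.
Qed.

Variables (K : numClosedFieldType) (L : lieSuperalgebraType K) (N : {vspace L}).
Hypothesis LLN : (bracketv (fullv : {vspace L}) fullv <= N)%VS.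
Implicit Types (F W J : {vspace L}) (x y w : L) (a b : bool) (c : K).

Definition stable W := (bracketv fullv W <= W)%VS.

Lemma stable_mem W x w : stable W -> w \in W -> bracket x w \in W.
Proof. by move=> sW wW; apply: subvP sW _ _; rewrite mem_bracketv ?memvf. Qed.

(** This makes the operators [ad x] supercommute modulo [F]. *)
Lemma bracket_mem_derived F x y w : (bracketv N N <= F)%VS -> w \in N ->
  bracket (bracket x y) w \in F.
Proof.
move=> sF wN; apply: subvP sF _ _; rewrite mem_bracketv //.
by apply: subvP LLN _ _; rewrite mem_bracketv ?memvf.
Qed.

Lemma graded_fullv : graded_subspace (fullv : {vspace L}).
Proof. by rewrite /graded_subspace !capfv homog_add. Qed.

(** For stable [F <= W], the preimage in [W] of the [c]-eigenspace of [ad x] on [W / F]. *)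
Definition eigen_mod F W x c : {vspace L} :=
  (W :&: (linfun (bracket x) - c *: \1)%VF @^-1: F)%VS.

Lemma mem_eigen_mod F W x c w :
  (w \in eigen_mod F W x c) = (w \in W) && (bracket x w - c *: w \in F).
Proof.
by rewrite memv_cap -memv_preim add_lfunE opp_lfunE scale_lfunE id_lfunE lfunE.
Qed.

(** Supercommuting operators preserve each other's eigenspaces up to a sign, which occurs only for
    odd [x]; then [c = 0] and the sign is harmless. *)
Lemma stable_eigen_mod F W a x c : (bracketv N N <= F)%VS -> (W <= N)%VS ->
  stable F -> stable W -> x \in homog a -> (a -> c = 0) ->
  stable (eigen_mod F W x c).
Proof.
move=> sNF sWN sF sW xa ac; apply: graded_bracketv_subP graded_fullv _.
move=> b y w _ yb; rewrite !mem_eigen_mod => /andP[wW wF].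
have wN := subvP sWN _ wW.
rewrite stable_mem //= (bracket_jacobi _ _ _ _ w xa yb) -addrA rpredD //.
  exact: bracket_mem_derived.
have := stable_mem y sF wF; rewrite linearB linearZ /=.
case: a xa ac => [_ /(_ isT) -> | _ _]; last by rewrite expr0 scale1r.
by rewrite !scale0r !subr0 => /rpredZ ->.
Qed.

Lemma eigen_mod_proper F W a x : (bracketv N N <= F)%VS -> (F <= W)%VS ->
  (W <= N)%VS -> stable W -> ~~ (W <= F)%VS -> x \in homog a ->
  exists2 c, (a -> c = 0) & ~~ (eigen_mod F W x c <= F)%VS.
Proof.
move=> sNF sFW sWN sW nWF; case: a => xa; last first.
  have fW : (linfun (bracket x) @: W <= W)%VS.
    by apply/subvP => _ /memv_imgP[w wW ->]; rewrite lfunE stable_mem.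
  have [c [w [wW wF wc]]] := eigenvector_mod sFW fW nWF.
  exists c => //; apply/subvPn; exists w => //.
  by rewrite mem_eigen_mod wW; rewrite lfunE in wc.
(* If ad x were injective modulo F, so would (ad x)^2 = ad [x, x] / 2 be,
   although [x, x] is in N and hence maps W into F. *)
exists 0 => //; apply: contra nWF => /subvP sE; apply/subvP => w wW.
have memE v : v \in W -> bracket x v \in F -> v \in F.
  by move=> vW xvF; apply: sE; rewrite mem_eigen_mod vW scale0r subr0.
apply/memE/memE => //; first exact: stable_mem.
have := bracket_jacobi _ _ _ _ w xa xa; rewrite expr1 scaleN1r.
move=> /eqP; rewrite -subr_eq opprK -mulr2n -scaler_nat => /eqP xxw.
have: 2%:R *: bracket x (bracket x w) \in F.
  by rewrite xxw bracket_mem_derived // (subvP sWN).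
by rewrite rpredZeq // pnatr_eq0.
Qed.

(* A minimal stable W above F works, each W :&: (ad x - c)^-1 F being stable. *)
Lemma scalar_step F W : (bracketv N N <= F)%VS -> stable F ->
  (F <= W)%VS -> (W <= N)%VS -> stable W -> ~~ (W <= F)%VS ->
  exists W', [/\ stable W', (F <= W')%VS, (W' <= N)%VS, ~~ (W' <= F)%VS &
    forall a x, x \in homog a ->
      exists2 c, (a -> c = 0) &
        forall w, w \in W' -> bracket x w - c *: w \in F].
Proof.
move=> sNF sF; have [n] := ubnP (\dim W); elim: n W => // n IHn W leWn.
move=> sFW sWN sW nWF.
have [scalW|] := classic (forall a x, x \in homog a ->
  exists2 c, (a -> c = 0) & forall w, w \in W -> bracket x w - c *: w \in F).
  by exists W.
move=> /not_all_ex_not[a] /not_all_ex_not[x] nx.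
have [xa nscal] := imply_to_and _ _ nx.
have [c ac nE] := eigen_mod_proper sNF sFW sWN sW nWF xa.
have sEW : (eigen_mod F W x c <= W)%VS by apply: capvSl.
apply: (IHn (eigen_mod F W x c)) => //.
- rewrite -ltnS; apply: leq_trans leWn; rewrite ltnS ltn_neqAle dimvS // andbT.
  (* At full dimension the eigenspace would be [W], and [x] would act as the scalar [c], against its
     choice. *)
  apply: contra_notN nscal => /eqP eqE; exists c => // w.
  have /eqP <- : eigen_mod F W x c == W by rewrite eqEdim sEW eqE leqnn.
  by rewrite mem_eigen_mod => /andP[].
- apply/subvP => w wF; rewrite mem_eigen_mod (subvP sFW) //.
  by rewrite rpredB ?rpredZ ?stable_mem.
- exact: subv_trans sWN.
- exact: stable_eigen_mod xa ac.
Qed.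

(** [P] is the kernel of the weight by which [L] acts on [W / F]. *)
Lemma weight_step F : (bracketv N N <= F)%VS -> stable F ->
  (F <= N)%VS -> ~~ (N <= F)%VS ->
  exists W P, [/\ stable W, (F <= W)%VS, (W <= N)%VS & ~~ (W <= F)%VS] /\
    [/\ (N <= P)%VS, (homog true <= P)%VS, (bracketv P W <= F)%VS &
        forall J, (\dim J <= (\dim (J :&: P)).+1)%N].
Proof.
move=> sNF sF sFN nNF.
have stN : stable N by apply: subv_trans LLN; apply: bracketvS; rewrite ?subvf.
have [W [sW sFW sWN nWF scalW]] := scalar_step sNF sF sFN (subvv _) stN nNF.
have [w0 w0W w0F] := subvPn nWF.
(* As [x] acts on [W / F] by a scalar, its value on the single vector [w0] outside [F] decides
   whether that scalar is 0. *)
pose P := (linfun (rbracket w0) @^-1: F)%VS.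
have memP x : (x \in P) = (bracket x w0 \in F) by rewrite -memv_preim lfunE.
(* The odd component acts by 0, so the scalar of [x] is that of its even component. *)
have scal x : exists c, forall w, w \in W -> bracket x w - c *: w \in F.
  have [x0 /scalW[c _ xc] [x1 /scalW[d d0 xd] ->]] := homog_sum x.
  exists c => w wW; rewrite bracketDl addrAC rpredD ?xc //.
  by have := xd _ wW; rewrite d0 // scale0r subr0.
exists W, P; split; split=> //.
- apply/subvP => x xN; rewrite memP; apply: subvP sNF _ _.
  by rewrite mem_bracketv // (subvP sWN).
- apply/subvP => x /scalW[c c0 xc]; rewrite memP.
  by have := xc _ w0W; rewrite c0 // scale0r subr0.
- apply/bracketv_subP => x w; rewrite memP => xP wW.
  have [c xc] := scal x.
  have c0 : c = 0.
    apply/eqP; apply: contraR w0F => nc.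
    have := rpredB xP (xc _ w0W).
    by rewrite opprB addrC subrK rpredZeq (negPf nc).
  by have := xc _ wW; rewrite c0 scale0r subr0.
move=> J; apply: dimv_cap_hyperplane => x z; rewrite memP => zP.
have [[c xc] [d zd]] := (scal x, scal z).
have d0 : d != 0.
  apply: contra zP => /eqP d0.
  by have := zd _ w0W; rewrite d0 scale0r subr0.
(* The weight of [x - (c / d) *: z] is [c - (c / d) * d = 0]. *)
exists (c / d); rewrite memP.
have := rpredB (xc _ w0W) (rpredZ (c / d) (zd _ w0W)).
rewrite scalerBr scalerA divfK // opprB addrA subrK.
by rewrite bracketBl bracketZl.
Qed.

(** Induction on the codimension of [F] in [N]: passing from [F] to [W] gains at least one
    dimension, and intersecting with [P] loses at most one. *)
Lemma weight_flag F : (bracketv N N <= F)%VS -> stable F -> (F <= N)%VS ->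
  exists J k, [/\ (N <= J)%VS, (homog true <= J)%VS,
    (iter_bracket J k N <= F)%VS &
    (\dim {:L} + \dim F <= \dim J + \dim N)%N].
Proof.
have [n] := ubnP (\dim N - \dim F)%N; elim: n F => // n IHn F leFn sNF sF sFN.
have [sNF'|nNF] := boolP (N <= F)%VS.
  by exists fullv, 0; rewrite !subvf leq_add2l dimvS.
have [W [P [[sW sFW sWN nWF] [sNP oP PW codimP]]]] :=
  weight_step sNF sF sFN nNF.
have ltFW : (\dim F < \dim W)%N.
  by rewrite ltn_neqAle dimvS // andbT (dimv_leqif_sup sFW).2.
have leWN := dimvS sWN.
have [||||J [k [sNJ oJ sk dimJ]]] := IHn W => //.
- rewrite -ltnS; apply: leq_trans leFn; rewrite ltnS.
  exact: ltn_sub2l (leq_trans ltFW leWN) ltFW.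
- exact: subv_trans sFW.
(* [J] takes [N] into [W] in [k] brackets; one more, by [P], reaches [F]. *)
exists (J :&: P)%VS, k.+1; split; rewrite ?subv_cap ?sNJ ?oJ //.
  apply: subv_trans PW; apply: bracketvS; first exact: capvSr.
  apply: subv_trans sk.
  by elim: (k) => //= j IHj; apply: bracketvS => //; apply: capvSl.
rewrite -ltnS -addnS; apply: leq_trans (leq_add (leqnn _) ltFW) _.
by apply: leq_trans dimJ _; rewrite -addSn leq_add2r.
Qed.

End WeightFlag.

(** * The dimension bound *)

Theorem theorem3p15 (R : realType) (L : lieSuperalgebraType (complex R))
    (N : {vspace L})
    (solvL : is_solvable (fullv : {vspace L}))
    (non_nilpL : ~ is_nilpotent (fullv : {vspace L}))
    (nilradN : is_nilradical N)
    (LLN : (bracketv (fullv : {vspace L}) fullv <= N)%VS) :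
  dim_quotient fullv N <= dim_quotient N (bracketv N N).
Proof.
have [[gN sN] nilN maxN] := nilradN.
have sNN : (bracketv N N <= N)%VS.
  by apply: subv_trans sN; rewrite bracketvS ?subvf.
have stN : stable (bracketv N N).
  rewrite /stable; apply: subv_trans (bracketv_jacobil _ (graded_fullv _) gN) _.
  have sLN : (bracketv fullv N <= N)%VS.
    by apply: subv_trans LLN; rewrite bracketvS ?subvf.
  by rewrite subv_add !bracketvS.
have [J [k [sNJ oJ sk dimJ]]] := weight_flag LLN (subvv _) stN sNN.
have sJ U V : (bracketv U V <= N)%VS.
  by apply: subv_trans LLN; rewrite bracketvS ?subvf.
(* [J] contains the whole odd part, so the modular law splits it. *)
have gJ : graded_subspace J.
  rewrite /graded_subspace (capv_idPr oJ) addvC.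
  by rewrite [(J :&: _)%VS]capvC vspace_modl // addvC homog_add capfv.
have JN : J = N.
  apply: maxN => //; first by split=> //; apply: subv_trans sNJ; apply: sJ.
  exact: nilpotent_mod_derived gJ gN (sJ _ _) (sJ _ _) nilN sk.
(* The bound becomes [dim L + dim [N, N] <= dim N + dim N]; complements turn it into the claim. *)
rewrite JN in dimJ.
have := dimv_cap_compl fullv N; have := dimv_cap_compl N (bracketv N N).
rewrite capfv (capv_idPr sNN) /dim_quotient => dimN dimL.
by move: dimJ; rewrite -dimL -addnA leq_add2l -dimN addnC leq_add2l.
Qed.
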